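(* For MLAPD on any rooted tree of depth $D$, the online algorithm \textsc{Waterfall} is $D$-competitive: on every instance, the total cost of its schedule is at most $D$ times the cost of an optimal schedule.
   Context: MLAPD: an instance is a rooted tree $\mathcal{T}$ with root $r$ and positive node costs $c(v)>0$, together with a set of requests $\rho=(v,a,d)$ issued at node $v$ with arrival time $a$ and deadline $d\ge a$ (deadlines distinct). A service $(S,t)$ is a subtree $S\ni r$ of $\mathcal{T}$ transmitted at time $t$, costing $c(S)=\sum_{u\in S}c(u)$; it satisfies $(v,a,d)$ if $v\in S$ and $a\le t\le d$. A feasible schedule satisfies every request; its cost is the sum of its service costs. Online: requests are revealed at arrival; the tree is known. Depth $D$: maximum number of nodes on a root-to-leaf path. $c$-competitive: cost at most $c$ times optimal on every instance. $\mathcal{T}_v$ is the subtree rooted at $v$. A request is pending at time $t$ if it has arrived by $t$ and was not satisfied by earlier transmissions. For a pending request $\rho$ in $\mathcal{T}_v$, $P(v\to\rho)$ is the node set of the path from $v$ to the node of $\rho$, $P_\rho=P(r\to\rho)$, and for a node set $S$, $P(v\to\rho\mid S)=P(v\to\rho)\setminus S$. \textsc{Waterfall}: every node $u$ carries a price $p(u)$, initialized to $c(u)$; write $p(X)=\sum_{u\in X}p(u)$. When a pending request $\rho$ reaches its deadline $t=d_\rho$: set $S=P_\rho$ and $p(v)=c(v)$ for $v\in P_\rho$; put the nodes of $P_\rho$ into a FIFO queue $Q$; while $Q\ne\emptyset$, dequeue a node $v$, run the $v$-fall on $S$ and enqueue every node it returns; finally transmit $(S,t)$. The $v$-fall: set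 $A=\emptyset$ and budget $b=c(v)$; go through the pending requests $\gamma$ in $\mathcal{T}_v$ in increasing order of deadline; for each, let $P=P(v\to\gamma\mid S)$ with the current $S$; if $p(P)>b$, replace $p(u)$ by $p(u)(1-b/p(P))$ for every $u\in P$ and stop; otherwise add $P$ to $A$ and to $S$, set $b\gets b-p(P)$, and reset $p(u)=c(u)$ for all $u\in P$. The $v$-fall returns $A$. *)

(* Defs.v *)
From HB Require Import structures.
From mathcomp Require Import all_boot all_order all_algebra.
Set Implicit Arguments. Unset Strict Implicit. Unset Printing Implicit Defensive.
Import Order.TTheory GRing.Theory Num.Theory.
Local Open Scope ring_scope.

Section MLAPD.
Variable R : realFieldType.
Variable V : finType.
Variable r : V.
Variable par : V -> V.

(* A rooted tree: the root is its own parent and every node reaches the root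
   by iterating the parent map (this rules out cycles). *)
Definition is_rooted_tree : Prop :=
  par r = r /\ forall v : V, exists n : nat, iter n par v = r.

Definition anc (u v : V) : bool := [exists n : 'I_#|V|, iter n par v == u].

(* node set of the path from u down to w (empty if w not in T_u) *)
Definition path_set (u w : V) : {set V} := [set x | anc u x && anc x w].
Definition root_path (v : V) : {set V} := [set x | anc x v].

Definition leaf (v : V) : bool := [forall w, (par w == v) ==> (w == v)].
Definition depth : nat := \max_(v | leaf v) #|root_path v|.

Definition request := (V * R * R)%type.
Definition rnode (q : request) : V := q.1.1.
Definition rarr (q : request) : R := q.1.2.
Definition rdead (q : request) : R := q.2.

(* Services: (subtree, time) *)
Definition service := ({set V} * R)%type.
Definition is_subtree (S : {set V}) : bool :=
  (r \in S) && [forall u in S, par u \in S].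
Definition satisfies (s : service) (q : request) : bool :=
  (rnode q \in s.1) && (rarr q <= s.2 <= rdead q).

Variable c : V -> R.

Definition set_cost (f : V -> R) (S : {set V}) : R := \sum_(u in S) f u.
Definition sched_cost (sched : seq service) : R :=
  \sum_(s <- sched) set_cost c s.1.

Definition feasible (reqs : seq request) (sched : seq service) : Prop :=
  (forall s, s \in sched -> is_subtree s.1) /\
  (forall q, q \in reqs -> has (fun s => satisfies s q) sched).

(* pending at time t w.r.t. the transmissions made so far (all earlier) *)
Definition pending (trans : seq service) (t : R) (q : request) : bool :=
  (rarr q <= t) && ~~ has (fun s => satisfies s q) trans.

Fixpoint vfall_loop (v : V) (l : seq request) (S : {set V}) (p : V -> R)
    (b : R) (A : {set V}) : {set V} * (V -> R) * {set V} :=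
  match l with
  | [::] => (S, p, A)
  | g :: l' =>
      let P := path_set v (rnode g) :\: S in
      let pP := set_cost p P in
      if b < pP then
        (S, (fun u => if u \in P then p u * (1 - b / pP) else p u), A)
      else
        vfall_loop v l' (S :|: P) (fun u => if u \in P then c u else p u)
          (b - pP) (A :|: P)
  end.

(* the v-fall on S; pend = pending requests sorted by increasing deadline.
   Returns (new S, new prices, A). *)
Definition vfall (pend : seq request) (v : V) (S : {set V}) (p : V -> R) :=
  vfall_loop v [seq g <- pend | anc v (rnode g)] S p (c v) set0.

Variable enq : {set V} -> seq V.  (* order in which a returned set is enqueued *)

(* FIFO queue processing; each node is enqueued at most once, so #|V|
   dequeue steps suffice. *)
Fixpoint queue_loop (pend : seq request) (n : nat) (Q : seq V) (S : {set V})
    (p : V -> R) : {set V} * (V -> R) :=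
  match n with
  | 0 => (S, p)
  | n'.+1 =>
      match Q with
      | [::] => (S, p)
      | v :: Q' =>
          let '(S1, p1, A1) := vfall pend v S p in
          queue_loop pend n' (Q' ++ enq A1) S1 p1
      end
  end.

Definition wf_step (sorted_reqs : seq request)
    (st : seq service * (V -> R)) (rho : request) : seq service * (V -> R) :=
  let '(trans, p) := st in
  let t := rdead rho in
  if pending trans t rho then
    let pend := [seq g <- sorted_reqs | pending trans t g] in
    let P := root_path (rnode rho) in
    let p0 := fun u => if u \in P then c u else p u in
    let '(S1, p1) := queue_loop pend #|V| (enq P) P p0 in
    (rcons trans (S1, t), p1)
  else (trans, p).

Definition waterfall (reqs : seq request) : seq service :=
  let sreqs := sort (fun x y : request => rdead x <= rdead y) reqs in
  (foldl (wf_step sreqs) ([::], c) sreqs).1.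

End MLAPD.

(* Main.v *)
Require Import Defs.
From HB Require Import structures.
From mathcomp Require Import all_boot all_order all_algebra.
From mathcomp Require Import zify ring lra.
Import Order.TTheory GRing.Theory Num.Theory.
Set Implicit Arguments.
Unset Strict Implicit.
Unset Printing Implicit Defensive.
Local Open Scope ring_scope.

(** Call (j, v) an item if v belongs to the j-th Waterfall service; the item
lasts until the next service of v. The v-fall of service j invests at most
c(v) in strict descendants of v; view each share as flow from the item (j,
v) to the item of the descendant that is current at that moment. An item (i,
w) receives at most c(w), and exactly c(w) if it ends with a service for
which w is not on the path of the triggering request. An item is good if the
reference schedule serves v while the item lasts. It is down if it is not
good, its fall exhausted the budget, and the reference schedule does not
serve v between the fall and the deadline of the request at which the fall
stopped. It is up if it has an end and is neither good nor down.

A request that is pending at a service had, at the previous service of a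
node above it, either not arrived yet or outlasted the budget of that node's
fall, which then stopped at that request or at one of earlier deadline.
Hence flow out of down items enters good or down items, flow into up items
leaves good or up items, and an item that ends on the path of a triggering
request is good or down. So down items send out all of their cost and up
items receive all of theirs. Flow descends in the tree: weighing it by the
level l(v) = 0, 1, ... of its endpoints bounds the cost of the down items by
the sum of l(v) c(v) over the good items, and reversing it bounds the cost
of the up items by the sum of (D - 1 - l(v)) c(v). The total cost is thus at
most D times the cost of the good items, and distinct good items of v are
charged to distinct services of v in the reference schedule. *)

Section Tree.
Variables (V : finType) (r : V) (par : V -> V).

Lemma anc_fconnect u v : anc par u v = fconnect par v u.
Proof.
apply/existsP/idP => [[n /eqP<-]|]; first exact: fconnect_iter.
move=> vu; have findex_lt : (findex par v u < #|V|)%N.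
  exact: leq_trans (findex_max vu) (max_card _).
by exists (Ordinal findex_lt); rewrite /= iter_findex.
Qed.

Lemma anc_refl v : anc par v v.
Proof. by rewrite anc_fconnect connect0. Qed.

Lemma anc_trans v u w : anc par u v -> anc par v w -> anc par u w.
Proof. by rewrite !anc_fconnect => uv vw; apply: connect_trans vw uv. Qed.

Lemma anc_subtree (X : {set V}) v w :
  is_subtree r par X -> w \in X -> anc par v w -> v \in X.
Proof.
case/andP=> _ /forall_inP par_closed wX.
rewrite anc_fconnect => /iter_findex <-.
by elim: findex => //= n IHn; apply: par_closed.
Qed.

Definition level (v : V) : nat := #|root_path par v :\ v|.

Lemma card_root_path v : #|root_path par v| = (level v).+1.
Proof. by rewrite (cardsD1 v) inE anc_refl add1n. Qed.

Hypothesis tree : is_rooted_tree r par.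

(* A node on a cycle of [par] is the root, since its orbit reaches the root,
   which is fixed by [par]. *)
Lemma anc_antisym u v : anc par u v -> anc par v u -> u = v.
Proof.
case: tree => par_r reach_r; rewrite !anc_fconnect => /iter_findex.
set a := findex par v u => iter_a /iter_findex.
set b := findex par u v => iter_b.
have iter_r n : iter n par r = r by elim: n => //= n ->.
have iter_period n : iter (n * (b + a)) par v = v.
  by elim: n => // n IHn; rewrite mulSn iterD IHn iterD iter_a iter_b.
have [/eqP|period_gt0] := posnP (b + a).
  by rewrite addn_eq0 => /andP[_ /eqP a0]; rewrite -iter_a a0.
have [n reach_n] := reach_r v.
have v_root : v = r.
  rewrite -(iter_period n) -(subnK (leq_pmulr n period_gt0)).
  by rewrite iterD reach_n iter_r.
by rewrite -iter_a v_root iter_r.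
Qed.

Lemma level_lt u v : anc par u v -> u != v -> (level u < level v)%N.
Proof.
move=> uv u_neq_v; rewrite -ltnS -!card_root_path; apply: proper_card.
apply/properP; split.
  by apply/subsetP => w; rewrite !inE => wu; apply: anc_trans wu uv.
exists v; rewrite inE ?anc_refl //.
by apply: contraNN u_neq_v => vu; rewrite (anc_antisym uv vu).
Qed.

Lemma level_lt_depth v : (level v < depth par)%N.
Proof.
pose u := [arg max_(u > v) level u].
have level_max w : (level w <= level u)%N.
  by rewrite /u; case: arg_maxnP => // i _; apply.
apply: leq_ltn_trans (level_max v) _; rewrite -card_root_path.
apply: (@leq_bigmax_cond _ _ (fun v => #|root_path par v|)).
apply/forallP => w; apply/implyP => /eqP par_w; apply: contraT => w_neq_u.
have uw : anc par u w by rewrite anc_fconnect -par_w fconnect1.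
by have := level_lt uw; rewrite eq_sym w_neq_u ltnNge level_max => /(_ isT).
Qed.

End Tree.

Section Flow.
Variables (R : realFieldType) (I : finType) (cost : I -> R).

(* Weigh the flow out of [X] by the height of its source plus one, hence by at
   most the height of its target: what [X] receives from itself cancels all but
   one unit of that weight. *)
Lemma cost_full_outflow_le (f : I -> I -> R) (height : I -> nat)
    (G X : pred I) :
  (forall a, X a -> ~~ G a) -> (forall a b, 0 <= f a b) ->
  (forall b, \sum_a f a b <= cost b) ->
  (forall a b, f a b != 0 -> (height a < height b)%N) ->
  (forall a, X a -> \sum_b f a b = cost a) ->
  (forall a b, X a -> f a b != 0 -> G b || X b) ->
  \sum_(a | X a) cost a <= \sum_(a | G a) (height a)%:R * cost a.
Proof.
move=> disjoint_GX f_ge0 inflow_le height_lt outflow_eq target.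
suff : \sum_(a | X a) (height a).+1%:R * cost a
    <= \sum_(b | G b || X b) (height b)%:R * cost b.
  rewrite [leRHS](bigID G) /= addrC -lerBlDl.
  rewrite [X in _ - X](eq_bigl X) => [|a]; last first.
    by have := disjoint_GX a; case: (G a) (X a) => [] [] // ->.
  rewrite -sumrB [leRHS](eq_bigl G) => [|a]; last by case: (G a) (X a) => [] [].
  apply: le_trans; apply: ler_sum => a _.
  by rewrite -mulrBl -natrB ?leqnSn // subSnn mul1r.
apply: (@le_trans _ _
  (\sum_(a | X a) \sum_(b | G b || X b) (height b)%:R * f a b)).
  apply: ler_sum => a aX; rewrite -(outflow_eq a aX) mulr_sumr.
  rewrite [leRHS]big_mkcond; apply: ler_sum => b _.
  have [->|fab] := eqVneq (f a b) 0; first by rewrite !mulr0 if_same.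
  by rewrite (target a b) // ler_wpM2r // ler_nat height_lt.
rewrite exchange_big; apply: ler_sum => b _ /=.
rewrite -mulr_sumr ler_wpM2l //; apply: le_trans (inflow_le b).
by rewrite [leLHS]big_mkcond; apply: ler_sum => a _; case: ifP.
Qed.

(* The bound on [up] is the bound on [down] for the reversed flow. *)
Lemma cost_flow_le (f : I -> I -> R) (lev : I -> nat) (D : nat)
    (good down up : pred I) :
  (forall a, down a -> ~~ good a) -> (forall a, up a -> ~~ good a) ->
  (forall a b, 0 <= f a b) ->
  (forall b, \sum_a f a b <= cost b) -> (forall a, \sum_b f a b <= cost a) ->
  (forall a b, f a b != 0 -> (lev a < lev b)%N) -> (forall a, (lev a < D)%N) ->
  (forall a, down a -> \sum_b f a b = cost a) ->
  (forall a b, down a -> f a b != 0 -> good b || down b) ->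
  (forall b, up b -> \sum_a f a b = cost b) ->
  (forall a b, up b -> f a b != 0 -> good a || up a) ->
  \sum_(a | good a) cost a + \sum_(a | down a) cost a + \sum_(a | up a) cost a
    <= D%:R * \sum_(a | good a) cost a.
Proof.
move=> down_good up_good f_ge0 inflow_le outflow_le lev_lt lev_ltD.
move=> down_full down_target up_full up_source.
have down_le :
    \sum_(a | down a) cost a <= \sum_(a | good a) (lev a)%:R * cost a.
  exact: (cost_full_outflow_le (f := f)).
have up_le :
    \sum_(a | up a) cost a <= \sum_(a | good a) (D.-1 - lev a)%:R * cost a.
  apply: (cost_full_outflow_le (f := fun a b => f b a) up_good) => // a b.
    by move=> /lev_lt; have := lev_ltD a; lia.
  by move=> aU; apply: up_source.
rewrite -addrA; apply: le_trans (lerD (lexx _) (lerD down_le up_le)) _.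
rewrite mulr_sumr -!big_split /= le_eqVlt; apply/orP; left; apply/eqP.
apply: eq_bigr => a _; rewrite -{1}[cost a]mul1r -!mulrDl -natrD nat1r.
by congr (_%:R * _); have := lev_ltD a; lia.
Qed.

End Flow.

Section LastServed.
Variable served : pred nat.

Fixpoint last_served (n : nat) : nat :=
  if n is n'.+1 then if served n then n else last_served n' else 0.

Lemma last_served_le n : (last_served n <= n)%N.
Proof. by elim: n => //= n IHn; case: ifP => // _; apply: leqW. Qed.

Lemma last_served_max n j : served j -> (j <= n)%N -> (j <= last_served n)%N.
Proof.
move=> served_j; elim: n => [|n IHn] /=; first by rewrite leqn0 => /eqP->.
case: ifPn => // unserved; rewrite leq_eqVlt => /predU1P[jE|]; last exact: IHn.
by rewrite -jE served_j in unserved.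
Qed.

Hypothesis served0 : served 0.

Lemma served_last n : served (last_served n).
Proof. by elim: n => //= n IHn; case: ifP. Qed.

Variables (R : realFieldType) (cost : R).

(* Both sides are the sum over all services less one term: the last service on
   the left, service [0] on the right. *)
Lemma sum_not_last_served n :
  \sum_(j < n.+1 | served j && (val j != last_served n)) cost
    = \sum_(k < n | served k.+1) cost.
Proof.
have last_lt : (last_served n < n.+1)%N by rewrite ltnS last_served_le.
apply: (addrI cost).
transitivity (\sum_(j < n.+1 | served j) cost).
  by rewrite [RHS](bigD1 (Ordinal last_lt)) //= served_last.
by rewrite big_mkcond big_ord_recl /= served0 -big_mkcond.
Qed.

(* The history of one node: step [k] pays [invested k] towards its price, and a
   [free] step serves it without collecting what is left of the price. *)
Variables (m : nat) (free : pred nat) (price invested : nat -> R).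
Hypothesis price_ge0 : forall j, (j <= m)%N -> 0 <= price j.
Hypothesis price_served : forall j, (j <= m)%N -> served j -> price j = cost.
Hypothesis invested_unserved : forall k, (k < m)%N -> ~~ served k.+1 ->
  invested k = price k - price k.+1.
Hypothesis invested_free : forall k, (k < m)%N -> free k -> invested k = 0.
Hypothesis invested_bought : forall k, (k < m)%N -> served k.+1 -> ~~ free k ->
  invested k = price k.

Definition received (n j : nat) : R :=
  \sum_(k < n | last_served k == j) invested k.

Lemma receivedS n j :
  received n.+1 j
    = received n j + (if last_served n == j then invested n else 0).
Proof. by rewrite /received !(big_mkcond (fun k => _ == j)) big_ord_recr. Qed.

Lemma invested_le k : (k < m)%N -> invested k <= price k.
Proof.
move=> km; case: (boolP (served k.+1)) => [served_k|unserved_k].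
  case: (boolP (free k)) => free_k; last by rewrite invested_bought.
  by rewrite invested_free // price_ge0 // ltnW.
by rewrite invested_unserved // lerBlDr lerDl price_ge0.
Qed.

Lemma received_last n : (n <= m)%N ->
  received n (last_served n) = cost - price n.
Proof.
elim: n => [_|n IHn nm].
  by rewrite /received big_ord0 price_served // subrr.
rewrite receivedS /=; case: ifPn => [served_n|unserved_n]; last first.
  by rewrite eqxx IHn 1?ltnW // invested_unserved //; ring.
rewrite ltn_eqF ?ltnS ?last_served_le // addr0 price_served // subrr.
apply: big_pred0 => k; apply: ltn_eqF; rewrite ltnS.
exact: leq_trans (last_served_le k) (ltnW (ltn_ord k)).
Qed.

Lemma received_le n j : (n <= m)%N -> received n j <= cost.
Proof.
elim: n => [_|n IHn nm].
  by rewrite /received big_ord0 -(price_served (leq0n m)) // price_ge0.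
rewrite receivedS; case: eqP => [<-|_]; last by rewrite addr0 IHn // ltnW.
by rewrite received_last 1?ltnW //; have := invested_le nm; lra.
Qed.

Lemma received_eq n j : (n <= m)%N -> (j <= n)%N -> served j ->
  j != last_served n ->
  (forall k, (k < n)%N -> free k -> last_served k != j) ->
  received n j = cost.
Proof.
move=> + + served_j; elim: n => [_|n IHn nm jn j_last not_free].
  by rewrite leqn0 => /eqP->; rewrite eqxx.
rewrite receivedS; have [lastE|last_neq] := eqVneq (last_served n) j.
  rewrite -{1}lastE received_last 1?ltnW // invested_bought ?subrK //.
    by move: j_last => /=; case: ifP => //; rewrite lastE eqxx.
  by apply: contraTN isT => /(not_free n (leqnn _)); rewrite lastE eqxx.
rewrite addr0; apply: IHn => [||| k kn]; last by apply: not_free; apply: leqW.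
- exact: ltnW.
- move: jn; rewrite leq_eqVlt => /predU1P[jE|//].
  by move: served_j j_last => /=; rewrite jE => ->; rewrite eqxx.
- by rewrite eq_sym.
Qed.

End LastServed.

Lemma setD_split (T : finType) (A B C : {set T}) :
  A \subset B -> B \subset C -> C :\: A = (B :\: A) :|: (C :\: B).
Proof.
move=> /subsetP AB /subsetP BC; apply/setP => w; rewrite !inE.
have [wB|wB] := boolP (w \in B); first by rewrite BC // andbT orbF.
by rewrite andbF (contraNN (AB w) wB).
Qed.

Section Falls.
Variables (R : realFieldType) (V : finType) (par : V -> V).
Variables (c : V -> R) (enq : {set V} -> seq V).
Hypothesis c_ge0 : forall v, 0 <= c v.

Implicit Types (P S Z : {set V}) (p : V -> R) (l pend : seq (request R V)).

Definition reset P p (u : V) : R := if u \in P then c u else p u.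

Definition discount P (e : R) p (u : V) : R :=
  if u \in P then p u * (1 - e) else p u.

(* A node bought between the two states (in [S1] but not in [S]) has paid all of
   its price; its new price is the one already reset to its cost. *)
Definition investment S S1 p p1 (w : V) : R :=
  p w - (if w \in S1 :\: S then 0 else p1 w).

Record purchase S p S1 p1 : Prop := {
  purchase_sub : S \subset S1;
  purchase_new : forall w, w \in S1 :\: S -> p1 w = c w;
  purchase_old : forall w, w \in S -> p1 w = p w;
  purchase_price_ge0 : forall w, 0 <= p1 w;
  purchase_investment_ge0 : forall w, 0 <= investment S S1 p p1 w }.

Lemma investment_same S p p1 w : investment S S p p1 w = p w - p1 w.
Proof. by rewrite /investment setDv inE. Qed.

Lemma investment_trans S S1 S2 p p1 p2 w :
  purchase S p S1 p1 -> purchase S1 p1 S2 p2 ->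
  investment S S2 p p2 w = investment S S1 p p1 w + investment S1 S2 p1 p2 w.
Proof.
move=> buy1 buy2; rewrite /investment !inE.
have [wS|wS] := boolP (w \in S).
  by rewrite (subsetP (purchase_sub buy1) w wS) /=; ring.
have [wS1|wS1] /= := boolP (w \in S1); last by case: ifP => _; ring.
by rewrite (subsetP (purchase_sub buy2) w wS1) (purchase_old buy2 wS1); ring.
Qed.

Lemma purchase_refl S p p1 :
  (forall w, 0 <= p w) -> p1 =1 p -> purchase S p S p1.
Proof.
move=> p_ge0 p1E; split=> // w; rewrite ?setDv ?inE ?p1E //.
by rewrite investment_same p1E subrr.
Qed.

Lemma purchase_trans S p S1 p1 S2 p2 :
  purchase S p S1 p1 -> purchase S1 p1 S2 p2 -> purchase S p S2 p2.
Proof.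
move=> buy1 buy2; split.
- exact: subset_trans (purchase_sub buy1) (purchase_sub buy2).
- move=> w; rewrite inE => /andP[wS wS2].
  have [wS1|wS1] := boolP (w \in S1).
    by rewrite (purchase_old buy2) // (purchase_new buy1) // inE wS.
  by rewrite (purchase_new buy2) // inE wS1.
- move=> w wS; rewrite (purchase_old buy2) ?(purchase_old buy1) //.
  exact: subsetP (purchase_sub buy1) w wS.
- exact: purchase_price_ge0 buy2.
- move=> w; rewrite (investment_trans w buy1 buy2).
  by rewrite addr_ge0 // purchase_investment_ge0.
Qed.

Section Path.
Variables (P S : {set V}) (p : V -> R).
Hypothesis disjoint_PS : [disjoint P & S].
Hypothesis p_ge0 : forall w, 0 <= p w.

Lemma investment_buy w :
  investment S (S :|: P) p (reset P p) w = if w \in P then p w else 0.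
Proof.
rewrite /investment /reset !inE; have [wP|_] := boolP (w \in P).
  by rewrite (disjointFr disjoint_PS wP) subr0.
by rewrite orbF andNb subrr.
Qed.

Lemma purchase_buy : purchase S p (S :|: P) (reset P p).
Proof.
split=> [|w|w wS|w|w]; first exact: subsetUl.
- by rewrite !inE /reset => /andP[/negbTE->] /= ->.
- by rewrite /reset (disjointFl disjoint_PS wS).
- by rewrite /reset; case: ifP.
- by rewrite investment_buy; case: ifP.
Qed.

Lemma investment_discount e w :
  investment S S p (discount P e p) w = if w \in P then p w * e else 0.
Proof. by rewrite investment_same /discount; case: ifP => _; ring. Qed.

Lemma purchase_discount e : 0 <= e <= 1 -> purchase S p S (discount P e p).
Proof.
case/andP=> e_ge0 e_le1; split=> // [w|w wS|w|w].
- by rewrite setDv inE.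
- by rewrite /discount (disjointFl disjoint_PS wS).
- by rewrite /discount; case: ifP => // _; rewrite mulr_ge0 // subr_ge0.
- by rewrite investment_discount; case: ifP => // _; apply: mulr_ge0.
Qed.

End Path.

Definition by_deadline (q q' : request R V) : bool := rdead q <= rdead q'.

Lemma by_deadline_trans : transitive by_deadline.
Proof. by move=> q2 q1 q3; apply: le_trans. Qed.

(* [stop] is the request whose path exceeded the remaining budget, if any. *)
Record fall_spec (v : V) l S p (b : R) S1 p1 (stop : option (request R V)) :
    Prop := {
  fall_purchase : purchase S p S1 p1;
  fall_spent_le : \sum_w investment S S1 p p1 w <= b;
  fall_spent_eq : stop -> \sum_w investment S S1 p p1 w = b;
  fall_target : forall w, investment S S1 p p1 w != 0 ->
    exists2 q, q \in l & [/\ w \notin S, anc par v w, anc par w (rnode q) &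
      forall g, stop = Some g -> by_deadline q g];
  fall_stop_mem : forall g, stop = Some g -> g \in l;
  fall_skipped : forall q, q \in l -> rnode q \notin S1 ->
    exists2 g, stop = Some g & by_deadline g q }.

Lemma fall_spec_nil v S p b :
  (forall w, 0 <= p w) -> 0 <= b -> fall_spec v [::] S p b S p None.
Proof.
move=> p_ge0 b_ge0; have noinv w : investment S S p p w = 0.
  by rewrite investment_same subrr.
by split=> // [||w]; rewrite ?noinv ?eqxx ?big1 //; apply: purchase_refl.
Qed.

Section FallStep.
Variables (v : V) (q : request R V) (l : seq (request R V)).
Variables (S : {set V}) (p : V -> R) (b : R).
Hypothesis sorted_ql : sorted by_deadline (q :: l).
Hypothesis p_ge0 : forall w, 0 <= p w.

Let P := path_set par v (rnode q) :\: S.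

Let disjoint_PS : [disjoint P & S].
Proof. by rewrite -setI_eq0 setIDAC setDIl setDv setI0. Qed.

Let by_deadline_head q' : q' \in l -> by_deadline q q'.
Proof. by move/(allP (order_path_min by_deadline_trans sorted_ql)). Qed.

Lemma fall_spec_stop : 0 <= b -> b < set_cost p P ->
  fall_spec v (q :: l) S p b S (discount P (b / set_cost p P) p) (Some q).
Proof.
move=> b_ge0 b_lt; have P_gt0 : 0 < set_cost p P by apply: le_lt_trans b_lt.
have spent : \sum_w investment S S p (discount P (b / set_cost p P) p) w = b.
  under eq_bigr do rewrite investment_discount.
  by rewrite -big_mkcond -mulr_suml -/(set_cost p P) mulrC divfK // gt_eqF.
split=> [||_|w|g [<-]|q'] //; rewrite ?mem_head ?spent //.
- apply: purchase_discount => //.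
  by rewrite divr_ge0 ?(ltW P_gt0) //= ler_pdivrMr // mul1r ltW.
- rewrite investment_discount; case: ifP; last by rewrite eqxx.
  rewrite !inE => /and3P[wS vw wq] _; exists q; rewrite ?mem_head //.
  by split=> // g [<-]; rewrite /by_deadline.
- rewrite inE => q'_ql _; exists q => //.
  by case/predU1P: q'_ql => [->|/by_deadline_head//]; rewrite /by_deadline.
Qed.

Lemma fall_spec_buy S1 p1 stop : anc par v (rnode q) ->
  fall_spec v l (S :|: P) (reset P p) (b - set_cost p P) S1 p1 stop ->
  fall_spec v (q :: l) S p b S1 p1 stop.
Proof.
move=> vq fall; have buy := purchase_buy disjoint_PS p_ge0.
have inv w := investment_trans w buy (fall_purchase fall).
have spent : \sum_w investment S S1 p p1 w
    = set_cost p P + \sum_w investment (S :|: P) S1 (reset P p) p1 w.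
  under eq_bigr do rewrite inv investment_buy //.
  by rewrite big_split -big_mkcond.
split=> [||stopped|w|g|q'].
- exact: purchase_trans buy (fall_purchase fall).
- by rewrite spent addrC -lerBrDr; apply: fall_spent_le fall.
- by rewrite spent (fall_spent_eq fall stopped) addrC subrK.
- rewrite inv investment_buy //; have [wP _|_] := boolP (w \in P).
    exists q; first exact: mem_head.
    move: wP; rewrite !inE => /and3P[wS vw wq]; split=> // g.
    by move/(fall_stop_mem fall)/by_deadline_head.
  rewrite add0r => /(fall_target fall)[q' q'l [wSP vw wq' q'_le]].
  exists q'; first by rewrite inE q'l orbT.
  by split=> //; apply: contraNN wSP => wS; rewrite inE wS.
- by move/(fall_stop_mem fall) => gl; rewrite inE gl orbT.
- rewrite inE => /predU1P[->|q'l]; last exact: fall_skipped fall _ q'l.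
  case/negP; apply: (subsetP (purchase_sub (fall_purchase fall))).
  by rewrite !inE vq anc_refl; case: (_ \in S).
Qed.

End FallStep.

Lemma vfall_loop_spec v l S p b (A : {set V}) :
  sorted by_deadline l -> (forall q, q \in l -> anc par v (rnode q)) ->
  (forall w, 0 <= p w) -> 0 <= b ->
  let: (S1, p1, A1) := vfall_loop par c v l S p b A in
  A1 = A :|: (S1 :\: S) /\ exists stop, fall_spec v l S p b S1 p1 stop.
Proof.
elim: l S p b A => [|q l IHl] S p b A sorted_ql anc_ql p_ge0 b_ge0 /=.
  by rewrite setDv setU0; split=> //; exists None; apply: fall_spec_nil.
set P := path_set par v (rnode q) :\: S.
case: ifPn => [b_lt|].
  rewrite setDv setU0; split=> //; exists (Some q).
  exact: fall_spec_stop.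
rewrite -leNgt => P_le.
have := IHl (S :|: P) (reset P p) (b - set_cost p P) (A :|: P).
rewrite -/(reset P p); case: vfall_loop => [[S1 p1] A1] [].
- exact: path_sorted sorted_ql.
- by move=> q' q'l; apply: anc_ql; rewrite inE q'l orbT.
- by move=> w; rewrite /reset; case: ifP.
- by rewrite subr_ge0.
move=> -> [stop fall]; split; last first.
  by exists stop; apply: fall_spec_buy => //; apply: anc_ql; apply: mem_head.
have SPS1 := purchase_sub (fall_purchase fall).
rewrite (setD_split (subsetUl S P) SPS1) setDUl setDv set0U setDDl setUid.
by rewrite setUA.
Qed.

(* [Z] is the queue at the start, so [Z :|: (S1 :\: S)] is the set of the nodes
   whose fall is run; [x v] and [stop v] describe the fall of [v]. *)
Record service_spec pend Z S p S1 p1 (x : V -> V -> R)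
    (stop : V -> option (request R V)) : Prop := {
  service_purchase : purchase S p S1 p1;
  service_invested : forall w, \sum_v x v w = investment S S1 p p1 w;
  service_spend_ge0 : forall v w, 0 <= x v w;
  service_spent_le : forall v, \sum_w x v w <= c v;
  service_spent_eq : forall v, stop v -> \sum_w x v w = c v;
  service_target : forall v w, x v w != 0 ->
    [/\ v \in Z :|: (S1 :\: S), anc par v w, v != w &
        exists2 q, q \in pend &
          anc par w (rnode q) /\ forall g, stop v = Some g -> by_deadline q g];
  service_skipped : forall v q, v \in Z :|: (S1 :\: S) -> q \in pend ->
    anc par v (rnode q) -> rnode q \notin S1 ->
    exists2 g, stop v = Some g & by_deadline g q }.

Lemma service_spec_idle pend S p p1 : (forall w, 0 <= p w) -> p1 =1 p ->
  service_spec pend set0 S p S p1 (fun _ _ => 0) (fun=> None).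
Proof.
move=> p_ge0 p1E; split=> // [|w|v|v w|v q].
- exact: purchase_refl.
- by rewrite investment_same p1E subrr big1.
- by rewrite big1.
- by rewrite eqxx.
- by rewrite setDv !inE.
Qed.

Lemma service_spec_fall pend Z S p S' p' S1 p1 v x stop stop_v :
  v \in Z -> Z \subset S ->
  fall_spec v [seq g <- pend | anc par v (rnode g)] S p (c v) S' p' stop_v ->
  service_spec pend (Z :\ v :|: (S' :\: S)) S' p' S1 p1 x stop ->
  service_spec pend Z S p S1 p1
    (fun u => if u == v then investment S S' p p' else x u)
    (fun u => if u == v then stop_v else stop u).
Proof.
move=> vZ ZS fall serv; have vS := subsetP ZS v vZ.
have S'S1 := purchase_sub (service_purchase serv).
have SS' := purchase_sub (fall_purchase fall).
set Z' := _ :|: (S' :\: S) in serv.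
have run : Z :|: (S1 :\: S) = v |: (Z' :|: (S1 :\: S')).
  by rewrite (setD_split SS' S'S1) !setUA setD1K.
have x_v w : x v w = 0.
  apply: contraTeq (subsetP SS' v vS) => /(service_target serv)[].
  by rewrite !inE eqxx vS /= => /andP[].
split=> [|w|u w|u|u|u w|u q].
- exact: purchase_trans (fall_purchase fall) (service_purchase serv).
- rewrite (investment_trans w (fall_purchase fall) (service_purchase serv)).
  rewrite (bigD1 v) //= eqxx -(service_invested serv).
  rewrite [in RHS](bigD1 v) //= x_v add0r.
  by congr (_ + _); apply: eq_bigr => u /negbTE ->.
- case: ifP => _; last exact: service_spend_ge0 serv _ _.
  exact: purchase_investment_ge0 (fall_purchase fall) _.
- case: eqP => [->|_]; first exact: fall_spent_le fall.
  exact: service_spent_le serv _.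
- case: eqP => [->|_]; first exact: fall_spent_eq fall.
  exact: service_spent_eq serv _.
- rewrite run in_setU1; case: (eqVneq u v) => [->|_] /=; last first.
    exact: service_target serv _ _.
  move=> /(fall_target fall)[q]; rewrite mem_filter => /andP[_ q_pend].
  case=> wS vw wq q_le; split=> //; last by exists q.
  by apply: contraNneq wS => <-.
- rewrite run in_setU1; case: (eqVneq u v) => [-> _|_] /=; last first.
    exact: service_skipped serv _ _.
  move=> q_pend vq qS1; apply: (fall_skipped fall).
    by rewrite mem_filter vq.
  by apply: contraNN qS1; apply: (subsetP S'S1).
Qed.

Section Triggered.
Variables (pend : seq (request R V)) (P : {set V}) (p : V -> R).
Variables (S1 : {set V}) (p1 : V -> R) (x : V -> V -> R).
Variable stop : V -> option (request R V).
Hypothesis serv : service_spec pend P P (reset P p) S1 p1 x stop.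

Lemma service_fallen : P :|: (S1 :\: P) = S1.
Proof.
by rewrite -{1}(setIidPr (purchase_sub (service_purchase serv))) setID.
Qed.

Lemma service_price w : w \in S1 -> p1 w = c w.
Proof.
rewrite -service_fallen inE => /orP[wP|]; last first.
  exact: purchase_new (service_purchase serv) _.
by rewrite (purchase_old (service_purchase serv)) // /reset wP.
Qed.

Lemma service_invested_unserved w : w \notin S1 -> \sum_v x v w = p w - p1 w.
Proof.
move=> wS1; have wP : w \notin P.
  by apply: contraNN wS1; rewrite -service_fallen inE => ->.
rewrite (service_invested serv) /investment inE (negbTE wS1) andbF.
by rewrite /reset (negbTE wP).
Qed.

Lemma service_invested_path w : w \in P -> \sum_v x v w = 0.
Proof.
move=> wP; rewrite (service_invested serv) /investment inE wP /=.
by rewrite (purchase_old (service_purchase serv)) // subrr.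
Qed.

Lemma service_invested_bought w : w \in S1 -> w \notin P -> \sum_v x v w = p w.
Proof.
move=> wS1 wP; rewrite (service_invested serv) /investment inE wP wS1 subr0.
by rewrite /reset (negbTE wP).
Qed.

End Triggered.

Hypothesis enqP : forall X : {set V}, perm_eq (enq X) (enum X).

Lemma mem_enq (X : {set V}) v : (v \in enq X) = (v \in X).
Proof. by rewrite (perm_mem (enqP X)) mem_enum. Qed.

Lemma enq_uniq (X : {set V}) : uniq (enq X).
Proof. by rewrite (perm_uniq (enqP X)) enum_uniq. Qed.

Lemma size_enq (X : {set V}) : size (enq X) = #|X|.
Proof. by rewrite (perm_size (enqP X)) cardE. Qed.

Lemma queue_loop_spec pend n (Q : seq V) S p :
  sorted by_deadline pend -> (forall w, 0 <= p w) ->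
  uniq Q -> {subset Q <= S} -> (size Q + #|~: S| <= n)%N ->
  let: (S1, p1) := queue_loop par c enq pend n Q S p in
  exists x stop, service_spec pend [set v in Q] S p S1 p1 x stop.
Proof.
move=> sorted_pend.
have nothing_queued S' p' : (forall w, 0 <= p' w) ->
    exists x stop, service_spec pend [set v in [::]] S' p' S' p' x stop.
  by move=> ?; rewrite set_nil; do 2!eexists; apply: service_spec_idle.
elim: n Q S p => [|n IHn] [|v Q] S p p_ge0 //=.
- by move=> *; apply: nothing_queued.
- by move=> *; apply: nothing_queued.
case/andP=> vQ uniqQ QS size_le.
have QS' u : u \in Q -> u \in S by move=> uQ; apply: QS; rewrite inE uQ orbT.
have sorted_v : sorted by_deadline [seq g <- pend | anc par v (rnode g)].
  exact: sorted_filter by_deadline_trans _ _ sorted_pend.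
have anc_v q :
    q \in [seq g <- pend | anc par v (rnode g)] -> anc par v (rnode q).
  by rewrite mem_filter => /andP[].
have := vfall_loop_spec S set0 sorted_v anc_v p_ge0 (c_ge0 v).
rewrite /vfall; case: vfall_loop => [[S' p'] A'] []; rewrite set0U.
move=> ->{A'} [stop_v fall]; have SS' := purchase_sub (fall_purchase fall).
have p'_ge0 := purchase_price_ge0 (fall_purchase fall).
have := IHn (Q ++ enq (S' :\: S)) S' p' p'_ge0.
case: queue_loop => [S1 p1] [].
- rewrite cat_uniq uniqQ enq_uniq andbT; apply/hasPn => w.
  by rewrite mem_enq inE => /andP[wS _]; apply: contraNN wS => /QS'.
- move=> w; rewrite mem_cat mem_enq inE => /orP[/QS'|/andP[]//].
  exact: subsetP SS' w.
- rewrite size_cat size_enq; have := cardsC S; have := cardsC S'.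
  have := cardsD S' S; rewrite (setIidPr SS'); have := subset_leq_card SS'.
  by move: size_le => /=; lia.
move=> x [stop serv]; do 2!eexists; apply: service_spec_fall _ _ fall _.
- by rewrite inE mem_head.
- by apply/subsetP => u; rewrite inE => /QS.
rewrite (_ : _ :|: _ = [set u in Q ++ enq (S' :\: S)]); first exact: serv.
apply/setP => u; rewrite !inE mem_cat mem_enq inE.
by have [->|] := eqVneq u v; rewrite ?(negbTE vQ).
Qed.

End Falls.

Lemma bounded_choice (T : Type) (y0 : T) (n : nat) (P : nat -> T -> Prop) :
  (forall k, (k < n)%N -> exists y, P k y) ->
  exists f : nat -> T, forall k, (k < n)%N -> P k (f k).
Proof.
move=> exP; have [|f fP] := @fin_all_exists _ _ (fun k : 'I_n => P k).
  by move=> k; apply: exP.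
exists (fun k => oapp f y0 (insub k)) => k kn; rewrite insubT /=.
exact: fP (Ordinal kn).
Qed.

Lemma card_has_le_count (I : finType) (T : Type) (P : I -> pred T) (Q : pred T)
    (s : seq T) :
  (forall y i j, P i y -> P j y -> i = j) -> (forall y i, P i y -> Q y) ->
  (#|[pred i | has (P i) s]| <= count Q s)%N.
Proof.
move=> P_inj PQ; elim: s => [|y s IHs]; first by rewrite eq_card0.
have -> : #|[pred i | has (P i) (y :: s)]|
    = #|[predU [pred i | P i y] & [pred i | has (P i) s]]|.
  by apply: eq_card => i; rewrite !inE.
set Py := [pred i | P i y]; set Ps := [pred i | has (P i) s].
rewrite -(leq_add2r #|[predI Py & Ps]|) cardUI.
apply: leq_trans (leq_addr _ _); rewrite leq_add //; case Qy: (Q y).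
  by apply/card_le1_eqP => i j; rewrite !inE => Pi Pj; apply: P_inj Pj Pi.
by rewrite eq_card0 // => i; apply: contraFF Qy; apply: PQ.
Qed.

Lemma sched_costE (R : realFieldType) (V : finType) (c : V -> R)
    (sched : seq (service R V)) :
  sched_cost c sched
    = \sum_w c w *+ count (fun s : service R V => w \in s.1) sched.
Proof.
rewrite /sched_cost /set_cost; under eq_bigr do rewrite big_mkcond.
rewrite exchange_big; apply: eq_bigr => w _.
by rewrite -big_mkcond big_const_seq iter_addr_0.
Qed.

Section Run.
Variables (R : realFieldType) (V : finType) (r : V) (par : V -> V).
Variables (c : V -> R) (enq : {set V} -> seq V).
Variables (reqs : seq (request R V)) (t0 : R).
Local Notation n := (size reqs).

Definition wf_run (k : nat) : seq (service R V) * (V -> R) :=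
  foldl (wf_step par c enq reqs) ([::], c) (take k reqs).
Definition past (k : nat) : seq (service R V) := (wf_run k).1.
Definition price (k : nat) : V -> R := (wf_run k).2.

Definition trigger (k : nat) : request R V := nth (r, 0, 0) reqs k.
Definition fires (k : nat) : bool :=
  pending (past k) (rdead (trigger k)) (trigger k).
Definition pend (k : nat) : seq (request R V) :=
  [seq g <- reqs | pending (past k) (rdead (trigger k)) g].
Definition trigger_path (k : nat) : {set V} :=
  if fires k then root_path par (rnode (trigger k)) else set0.
Definition bought (k : nat) : {set V} * (V -> R) :=
  queue_loop par c enq (pend k) #|V| (enq (trigger_path k)) (trigger_path k)
    (reset c (trigger_path k) (price k)).

(* Service [0] is a fictitious service of all nodes at a time before every
   arrival; service [k.+1] is the one triggered by the [k]-th request, and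
   serves no node if that request is not pending at its deadline. *)
Definition served (j : nat) : {set V} :=
  if j is k.+1 then if fires k then (bought k).1 else set0 else setT.
Definition time (j : nat) : R := if j is k.+1 then rdead (trigger k) else t0.

Lemma wf_runS k : (k < n)%N ->
  wf_run k.+1 = if fires k then
    (rcons (past k) (served k.+1, time k.+1), (bought k).2) else wf_run k.
Proof.
move=> k_lt; rewrite /wf_run (take_nth (r, 0, 0)) // foldl_rcons -/(wf_run k).
rewrite /served /bought /trigger_path /pend /fires /past /price /reset.
rewrite -/(trigger k).
case: (wf_run k) => [trans p] /=; case: ifP => //= _.
by case: queue_loop.
Qed.

Lemma satisfied_pastP k q : (k <= n)%N ->
  reflect (exists2 j, (j < k)%N & satisfies (served j.+1, time j.+1) q)
    (has (fun s => satisfies s q) (past k)).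
Proof.
move=> k_le; apply: (iffP idP).
  elim: k k_le => [|k IHk] k_le; first by rewrite /past /wf_run take0.
  have earlier := IHk (ltnW k_le).
  have weaken : (exists2 j, (j < k)%N & satisfies (served j.+1, time j.+1) q) ->
      exists2 j, (j < k.+1)%N & satisfies (served j.+1, time j.+1) q.
    by case=> j jk; exists j; first exact: leqW.
  rewrite {1}/past wf_runS //; case: ifP => _ /=; last by move/earlier.
  by rewrite has_rcons => /orP[|/earlier//]; exists k.
elim: k k_le => [|k IHk] k_le [j] //; rewrite ltnS leq_eqVlt.
rewrite {1}/past wf_runS //; case: ifPn => [_|nfires] /predU1P[->|jk] sat.
- by rewrite /= has_rcons sat.
- by rewrite /= has_rcons IHk ?orbT //; [exact: ltnW | exists j].
- by move: sat; rewrite /satisfies /served (negbTE nfires) inE.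
- by apply: IHk; [exact: ltnW | exists j].
Qed.

Lemma sched_cost_past k : (k <= n)%N ->
  sched_cost c (past k) = \sum_(i < k) set_cost c (served i.+1).
Proof.
rewrite /sched_cost; elim: k => [|k IHk] k_le.
  by rewrite /past /wf_run take0 big_nil big_ord0.
rewrite big_ord_recr /= -IHk 1?ltnW // {1}/past wf_runS //.
case: ifP => fires_k; first by rewrite big_rcons /= fires_k addrC.
by rewrite [set_cost c set0]big_set0 addr0.
Qed.

Hypothesis c_ge0 : forall v, 0 <= c v.
Hypothesis enqP : forall X : {set V}, perm_eq (enq X) (enum X).
Hypothesis t0_lt : forall q, q \in reqs -> t0 < rarr q.
Hypothesis arr_le : forall q, q \in reqs -> rarr q <= rdead q.
Hypothesis reqs_sorted : sorted <%O [seq rdead q | q <- reqs].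

Lemma trigger_mem k : (k < n)%N -> trigger k \in reqs.
Proof. exact: mem_nth. Qed.

Lemma time_lt i j : (i < j <= n)%N -> time i < time j.
Proof.
case: j => // j; case: i => [|i] /andP[ij j_lt] /=.
  exact: lt_le_trans (t0_lt (trigger_mem j_lt)) (arr_le (trigger_mem j_lt)).
have i_lt : (i < n)%N by apply: ltn_trans j_lt.
rewrite /trigger -!(nth_map _ 0 (@rdead R V)) //.
by rewrite lt_sorted_ltn_nth // inE size_map.
Qed.

Lemma time_le i j : (i <= j <= n)%N -> time i <= time j.
Proof.
case/andP; rewrite leq_eqVlt => /predU1P[->//|ij] j_le.
by apply/ltW/time_lt; rewrite ij.
Qed.

Definition step_spec (k : nat) (x : V -> V -> R)
    (stop : V -> option (request R V)) : Prop :=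
  service_spec par c (pend k) (trigger_path k) (trigger_path k)
    (reset c (trigger_path k) (price k)) (served k.+1) (price k.+1) x stop.

Lemma step_exists k : (k < n)%N -> (forall w, 0 <= price k w) ->
  exists x stop, step_spec k x stop.
Proof.
move=> k_lt price_ge0; rewrite /step_spec.
have reset_ge0 w : 0 <= reset c (trigger_path k) (price k) w.
  by rewrite /reset; case: ifP.
rewrite {2}/price wf_runS // /served.
case: ifPn => [fires_k|nfires]; last first.
  rewrite /trigger_path (negbTE nfires); do 2!eexists.
  by apply: service_spec_idle => w; rewrite /reset ?inE.
have sorted_pend : sorted (@by_deadline R V) (pend k).
  apply: sorted_filter (@by_deadline_trans R V) _ _ _.
  move: reqs_sorted; rewrite sorted_map.
  by apply: sub_sorted => q q'; apply: ltW.
have := @queue_loop_spec _ _ par c enq c_ge0 enqP (pend k) #|V|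
  (enq (trigger_path k)) (trigger_path k) (reset c (trigger_path k) (price k))
  sorted_pend reset_ge0 (enq_uniq enqP _).
rewrite -/(bought k); case: (bought k) => [S1 p1] [] /=.
- by move=> w; rewrite mem_enq.
- by rewrite size_enq // cardsC.
have -> : [set v in enq (trigger_path k)] = trigger_path k.
  by apply/setP => v; rewrite inE mem_enq.
by move=> x serv; exists x.
Qed.

Lemma price_ge0 k : (k <= n)%N -> forall w, 0 <= price k w.
Proof.
elim: k => [|k IHk] k_le; first by rewrite /price /wf_run take0.
have [x [stop serv]] := step_exists k_le (IHk (ltnW k_le)).
exact: purchase_price_ge0 (service_purchase serv).
Qed.

Lemma pend_mem k q : q \in pend k -> q \in reqs.
Proof. by rewrite mem_filter => /andP[]. Qed.

Lemma trigger_path_pend k w : (k < n)%N -> w \in trigger_path k ->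
  trigger k \in pend k /\ anc par w (rnode (trigger k)).
Proof.
move=> k_lt; rewrite /trigger_path.
case: ifPn => [fires_k|_]; rewrite inE // => wq.
by rewrite mem_filter -/(fires k) fires_k trigger_mem.
Qed.

Lemma trigger_satisfied k : (k < n)%N ->
  has (fun s => satisfies s (trigger k)) (past k.+1).
Proof.
move=> k_lt; have arr := arr_le (trigger_mem k_lt).
have [fires_k|] := boolP (fires k); last first.
  rewrite /fires /pending arr negbK.
  case/(satisfied_pastP _ (ltnW k_lt)) => j jk sat.
  by apply/satisfied_pastP => //; exists j; first exact: leqW.
have [x [stop serv]] := step_exists k_lt (price_ge0 (ltnW k_lt)).
apply/satisfied_pastP => //; exists k; rewrite // /satisfies /= arr lexx !andbT.
apply: (subsetP (purchase_sub (service_purchase serv))).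
by rewrite /trigger_path fires_k inE anc_refl.
Qed.

Lemma pend_time_le k q :
  (k < n)%N -> q \in pend k -> time k.+1 <= rdead q.
Proof.
move=> k_lt; rewrite mem_filter => /andP[/andP[_ unsat]].
case/(nthP (r, 0, 0)) => i i_lt qE.
have -> : rdead q = time i.+1 by rewrite /= /trigger qE.
have [ki|ik] := leqP k i; first by rewrite time_le // ltnS ki.
case/negP: unsat; rewrite -qE -/(trigger i).
have /satisfied_pastP[//|j ji sat] := trigger_satisfied i_lt.
apply/satisfied_pastP; first exact: ltnW.
by exists j; first exact: leq_trans ik.
Qed.

Lemma pend_earlier j k q : (j < k < n)%N -> q \in pend k ->
  rarr q <= time j.+1 -> q \in pend j /\ rnode q \notin served j.+1.
Proof.
case/andP=> jk k_lt q_pend arr; have dead := pend_time_le k_lt q_pend.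
move: q_pend; rewrite !mem_filter => /andP[/andP[_ unsat] ->].
rewrite /pending arr andbT; split.
  apply: contraNN unsat => /satisfied_pastP[|i ij sat].
    exact: ltnW (ltn_trans jk k_lt).
  apply/satisfied_pastP; first exact: ltnW.
  by exists i; first exact: ltn_trans jk.
apply: contraNN unsat => q_served; apply/satisfied_pastP; first exact: ltnW.
exists j; rewrite // /satisfies q_served arr; apply: le_trans dead.
by rewrite time_le // ltnS ltnW.
Qed.

Section Charging.
Variables (x : nat -> V -> V -> R) (stop : nat -> V -> option (request R V)).
Hypothesis services : forall k, (k < n)%N -> step_spec k (x k) (stop k).
Variable sched : seq (service R V).
Hypothesis tree : is_rooted_tree r par.
Hypothesis feas : feasible r par reqs sched.

Definition visits (w : V) : pred nat := fun j => w \in served j.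

Definition last_service (k : nat) (w : V) : nat := last_served (visits w) k.

Definition hits (s : service R V) (j : nat) (v : V) : bool :=
  [&& v \in s.1, time j < s.2 &
      [forall k : 'I_n.+1, (j < k)%N && (v \in served k) ==> (s.2 <= time k)]].

Definition idle (v : V) (a b : R) : bool :=
  ~~ has (fun s : service R V => (v \in s.1) && (a < s.2 <= b)) sched.

Definition good (j : nat) (v : V) : bool := has (fun s => hits s j v) sched.

Definition down (j : nat) (v : V) : bool :=
  ~~ good j v &&
  (if j is k.+1 then
     if stop k v is Some g then idle v (time j) (rdead g) else false
   else false).

Definition ended (j : nat) (v : V) : bool := j != last_service n v.

Definition up (j : nat) (v : V) : bool :=
  [&& ~~ good j v, ~~ down j v & ended j v].

Lemma idle_cat v a b d : idle v a b -> idle v b d -> idle v a d.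
Proof.
move=> /hasPn idle_ab /hasPn idle_bd; apply/hasPn => s s_sched.
have := idle_ab s s_sched; have := idle_bd s s_sched; case: (v \in s.1) => //=.
by case: (ltP a s.2) => //= _; case: (ltP b s.2).
Qed.

Lemma idle_anc v w a b : anc par v w -> idle v a b -> idle w a b.
Proof.
move=> vw; apply: contraNN => /hasP[s s_sched /andP[ws s_ab]].
by apply/hasP; exists s; rewrite // s_ab (anc_subtree (feas.1 s s_sched) ws vw).
Qed.

Lemma idle_le v a b d : b <= d -> idle v a d -> idle v a b.
Proof.
move=> bd; apply: contraNN => /hasP[s s_sched /and3P[vs after sb]].
by apply/hasP; exists s; rewrite // vs after (le_trans sb).
Qed.

Lemma not_good_idle k w : (k < n)%N -> ~~ good (last_service k w) w ->
  idle w (time (last_service k w)) (time k.+1).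
Proof.
move=> k_lt /hasPn ngood; apply/hasPn => s s_sched.
apply: contraNN (ngood s s_sched) => /and3P[ws after before].
rewrite /hits ws after /=; apply/forallP => i; apply/implyP => /andP[last_i wi].
apply: le_trans before _; apply: time_le; rewrite leq_ord andbT.
rewrite ltnNge; apply: contraTN last_i => ik; rewrite -leqNgt.
exact: last_served_max.
Qed.

(* The reference schedule serves [q], hence [w], at a time which can only
   precede the last service of [w]. So [q] was already pending at that service,
   and made the fall of [w] stop there or earlier. *)
Lemma pending_down k w q : (k < n)%N -> q \in pend k ->
  anc par w (rnode q) -> idle w (time k.+1) (rdead q) ->
  ~~ good (last_service k w) w -> down (last_service k w) w.
Proof.
move=> k_lt q_pend wq idle_w ngood.
have {}idle_w := idle_cat (not_good_idle k_lt ngood) idle_w.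
have arr : rarr q <= time (last_service k w).
  have /hasP[s s_sched /and3P[qs qa qd]] := feas.2 q (pend_mem q_pend).
  have ws := anc_subtree (feas.1 s s_sched) qs wq.
  rewrite leNgt; apply: contraL idle_w => lt_arr; rewrite negbK.
  by apply/hasP; exists s; rewrite // ws qd (lt_le_trans lt_arr).
have w_served : w \in served (last_service k w).
  by apply: (served_last (served := visits w)); rewrite /visits inE.
have last_le : (last_service k w <= k)%N by apply: last_served_le.
rewrite /down ngood /=.
case: (last_service k w) => [|j] in idle_w arr w_served last_le *.
  by move: arr; rewrite leNgt t0_lt // (pend_mem q_pend).
have j_lt := ltn_trans last_le k_lt; have serv := services j_lt.
have [|q_pend_j q_unserved] := pend_earlier _ q_pend arr.
  by rewrite last_le.
have [|g -> gq] := service_skipped serv _ q_pend_j wq q_unserved.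
  by rewrite (service_fallen serv).
exact: idle_le gq idle_w.
Qed.

Lemma down_target_good_or_down k v w :
  (k < n)%N -> down k.+1 v -> x k v w != 0 ->
  good (last_service k w) w || down (last_service k w) w.
Proof.
move=> k_lt /andP[_]; case stop_v: (stop k v) => [g|//] idle_v.
case/(service_target (services k_lt)) => _ vw _ [q q_pend [wq q_le]].
have [//|ngood] := boolP (good _ _); apply: pending_down k_lt q_pend wq _ ngood.
by apply: idle_le (idle_anc vw idle_v); apply: q_le.
Qed.

Lemma up_source_good_or_up k v w : (k < n)%N -> x k v w != 0 ->
  up (last_service k w) w -> good k.+1 v || up k.+1 v.
Proof.
move=> k_lt xvw /and3P[ngood ndown _].
have [_ vw _ [q q_pend [wq q_le]]] := service_target (services k_lt) xvw.
have [//|ngood_v /=] := boolP (good k.+1 v).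
have busy_v : ~~ idle v (time k.+1) (rdead q).
  apply: contraNN ndown => idle_v; apply: pending_down k_lt q_pend wq _ ngood.
  exact: idle_anc vw idle_v.
apply/and3P; split=> //.
  rewrite /down ngood_v /=; case stop_v: (stop k v) => [g|//].
  by apply: contraNN busy_v; apply: idle_le; apply: q_le.
apply: contraNneq ngood_v => last_v.
have /hasP[s s_sched /and3P[vs after _]] := negbNE busy_v.
apply/hasP; exists s; rewrite // /hits vs after; apply/forallP => i.
apply/implyP => /andP[ki vi].
have := @last_served_max (visits v) _ _ vi (leq_ord i).
by rewrite -/(last_service _ v) -last_v leqNgt ki.
Qed.

Lemma trigger_path_good_or_down k w : (k < n)%N -> w \in trigger_path k ->
  good (last_service k w) w || down (last_service k w) w.
Proof.
move=> k_lt /(trigger_path_pend k_lt)[q_pend wq].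
have [//|ngood] := boolP (good _ _); apply: pending_down k_lt q_pend wq _ ngood.
by apply/hasPn => s _; case: ltP; rewrite ?andbF // => ->.
Qed.

Definition item (A : nat -> V -> bool) : pred ('I_n.+1 * V) :=
  fun a => (a.2 \in served a.1) && A a.1 a.2.

Lemma sum_item (A : nat -> V -> bool) :
  \sum_(a | item A a) c a.2
    = \sum_w \sum_(j < n.+1 | (w \in served j) && A j w) c w.
Proof. by rewrite (exchange_big_dep predT) //= pair_big_dep. Qed.

Lemma good_cost_le : \sum_(a | item good a) c a.2 <= sched_cost c sched.
Proof.
rewrite sum_item sched_costE; apply: ler_sum => w _; rewrite sumr_const.
apply: ler_wpMn2l => //.
pose hit (j : 'I_n.+1) s := (w \in served j) && hits s j w.
pose serves_w (s : service R V) := w \in s.1.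
apply: leq_trans (card_has_le_count (P := hit) (Q := serves_w) sched _ _).
- apply: subset_leq_card; apply/subsetP => j; rewrite !inE.
  by case/andP=> wj /hasP[s ss sj]; apply/hasP; exists s; rewrite // /hit wj.
- move=> s i j /andP[wi /and3P[_ ti /forallP ni]].
  case/andP=> wj /and3P[_ tj /forallP nj].
  apply: val_inj; case: (ltngtP i j) => // ij.
    by have := ni j; rewrite ij wj /= leNgt tj.
  by have := nj i; rewrite ij wi /= leNgt ti.
- by move=> s j /andP[_ /and3P[]].
Qed.

Lemma sched_cost_ended :
  sched_cost c (past n) = \sum_(a | item ended a) c a.2.
Proof.
rewrite sched_cost_past // sum_item /set_cost (exchange_big_dep predT) //=.
apply: eq_bigr => w _.
by rewrite (sum_not_last_served (served := visits w)) // /visits inE.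
Qed.

Definition flow (a b : 'I_n.+1 * V) : R :=
  if nat_of_ord a.1 is k.+1 then
    if last_service k b.2 == b.1 then x k a.2 b.2 else 0
  else 0.

Lemma flow_neq0 a b : flow a b != 0 ->
  exists k, [/\ nat_of_ord a.1 = k.+1, (k < n)%N, last_service k b.2 = b.1 &
    x k a.2 b.2 != 0].
Proof.
rewrite /flow; case aE: (nat_of_ord a.1) => [|k]; first by rewrite eqxx.
case: ifP => [/eqP lastE|]; last by rewrite eqxx.
by exists k; split=> //; have := ltn_ord a.1; rewrite aE ltnS.
Qed.

Lemma inflowE b : \sum_a flow a b =
  received (visits b.2) (fun k => \sum_v x k v b.2) n b.1.
Proof.
rewrite -(pair_bigA _ (fun i v => flow (i, v) b)) big_ord_recl /= {1}/flow /=.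
rewrite big1 // add0r /received [RHS]big_mkcond; apply: eq_bigr => k _.
by rewrite /flow /=; case: ifP => // _; rewrite big1.
Qed.

Lemma outflowE a : \sum_b flow a b =
  if nat_of_ord a.1 is k.+1 then \sum_w x k a.2 w else 0.
Proof.
rewrite /flow; case aE: (nat_of_ord a.1) => [|k]; first by rewrite big1.
rewrite -(pair_bigA _ (fun (j : 'I_n.+1) w =>
  if last_service k w == j then x k a.2 w else 0)) exchange_big.
apply: eq_bigr => w _ /=.
have last_lt : (last_service k w < n.+1)%N.
  apply: leq_ltn_trans (last_served_le _ _) _; apply: ltn_trans (ltn_ord a.1).
  by rewrite aE.
by rewrite -big_mkcond (big_pred1 (Ordinal last_lt)).
Qed.

Lemma price_served w j : (j <= n)%N -> w \in served j -> price j w = c w.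
Proof.
case: j => [|k] k_le; first by rewrite /price /wf_run take0.
exact: service_price (services k_le) w.
Qed.

Lemma inflow_le b : \sum_a flow a b <= c b.2.
Proof.
rewrite inflowE.
apply: (received_le (served := visits b.2) _
  (fun j j_le => price_ge0 j_le b.2) (@price_served b.2)
  (fun k k_lt => service_invested_unserved (services k_lt) (w := b.2))
  (fun k k_lt => service_invested_path (services k_lt) (w := b.2))
  (fun k k_lt => service_invested_bought (services k_lt) (w := b.2))) => //.
by rewrite /visits inE.
Qed.

Lemma inflow_up b : item up b -> \sum_a flow a b = c b.2.
Proof.
case/andP=> served_b /and3P[ngood ndown ended_b]; rewrite inflowE.
apply: (received_eq (served := visits b.2) _ (@price_served b.2)
  (fun k k_lt => service_invested_unserved (services k_lt) (w := b.2))
  (fun k k_lt => service_invested_bought (services k_lt) (w := b.2))) => //.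
- by rewrite /visits inE.
- exact: leq_ord.
move=> k k_lt /(trigger_path_good_or_down k_lt); apply: contraTneq => lastE.
by rewrite -[last_service k b.2]/(last_served _ k) lastE negb_or ngood.
Qed.

Lemma outflow_le a : \sum_b flow a b <= c a.2.
Proof.
rewrite outflowE; case aE: (nat_of_ord a.1) => [//|k].
have k_lt : (k < n)%N by rewrite -ltnS -aE ltn_ord.
exact: service_spent_le (services k_lt) _.
Qed.

Lemma outflow_down a : item down a -> \sum_b flow a b = c a.2.
Proof.
case/andP=> _ /andP[_]; rewrite outflowE.
case aE: (nat_of_ord a.1) => [//|k].
have k_lt : (k < n)%N by rewrite -ltnS -aE ltn_ord.
case stop_a: (stop k a.2) => [g|//] _.
by apply: service_spent_eq (services k_lt) _ _; rewrite stop_a.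
Qed.

Lemma flow_ge0 a b : 0 <= flow a b.
Proof.
have [->//|/flow_neq0[k [aE k_lt lastE _]]] := eqVneq (flow a b) 0.
by rewrite /flow aE lastE eqxx; apply: service_spend_ge0 (services k_lt) _ _.
Qed.

Lemma flow_level a b : flow a b != 0 -> (level par a.2 < level par b.2)%N.
Proof.
case/flow_neq0=> k [_ k_lt _ /(service_target (services k_lt))[_ ab a_neq_b _]].
exact: (level_lt tree ab a_neq_b).
Qed.

Lemma flow_down_target a b : item down a -> flow a b != 0 ->
  item good b || item down b.
Proof.
case/andP=> _ down_a /flow_neq0[k [aE k_lt lastE xab]].
rewrite aE in down_a; rewrite /item -andb_orr -lastE.
rewrite (down_target_good_or_down k_lt down_a xab) andbT.
by apply: (served_last (served := visits b.2)); rewrite /visits inE.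
Qed.

Lemma flow_up_source a b : item up b -> flow a b != 0 ->
  item good a || item up a.
Proof.
case/andP=> _ up_b /flow_neq0[k [aE k_lt lastE xab]].
rewrite -lastE in up_b; rewrite /item -andb_orr aE.
rewrite (up_source_good_or_up k_lt xab up_b) andbT.
have [] := service_target (services k_lt) xab.
by rewrite (service_fallen (services k_lt)).
Qed.

Lemma cost_ended_le :
  \sum_(a | item ended a) c a.2 <= \sum_(a | item good a) c a.2
    + \sum_(a | item down a) c a.2 + \sum_(a | item up a) c a.2.
Proof.
rewrite !(big_mkcond (item _)) -!big_split /=; apply: ler_sum => a _.
rewrite /item /up; have := c_ge0 a.2; case: (a.2 \in _) => /=; last by lra.
by case: (good _ _) (down _ _) (ended _ _) => [] [] [] /=; lra.
Qed.

Lemma sched_cost_past_le :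
  sched_cost c (past n) <= (depth par)%:R * sched_cost c sched.
Proof.
rewrite sched_cost_ended; apply: le_trans cost_ended_le _.
apply: le_trans (ler_wpM2l (ler0n _ _) good_cost_le).
have not_good (a : 'I_n.+1 * V) : ~~ good a.1 a.2 -> ~~ item good a.
  by rewrite /item negb_and orbC => ->.
apply: (cost_flow_le (cost := fun a => c a.2) (lev := fun a => level par a.2)).
- by move=> a /andP[_ /andP[/not_good]].
- by move=> a /andP[_ /andP[/not_good]].
- exact: flow_ge0.
- exact: inflow_le.
- exact: outflow_le.
- exact: flow_level.
- by move=> a; apply: level_lt_depth tree _.
- exact: outflow_down.
- exact: flow_down_target.
- exact: inflow_up.
- exact: flow_up_source.
Qed.

End Charging.

Lemma wf_run_competitive (sched : seq (service R V)) :
  is_rooted_tree r par -> feasible r par reqs sched ->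
  sched_cost c (past n) <= (depth par)%:R * sched_cost c sched.
Proof.
move=> tree feas.
pose falls := ((V -> V -> R) * (V -> option (request R V)))%type.
have [|y services] := @bounded_choice falls (fun _ _ => 0, fun=> None) n
    (fun k y => step_spec k y.1 y.2).
  move=> k k_lt.
  have [x [stop serv]] := step_exists k_lt (price_ge0 (ltnW k_lt)).
  by exists (x, stop).
exact: (sched_cost_past_le (x := fun k => (y k).1) (stop := fun k => (y k).2)).
Qed.

End Run.

Theorem mainTheorem6 (R : realFieldType) (V : finType) (r : V) (par : V -> V)
    (c : V -> R) (enq : {set V} -> seq V) (reqs : seq (request R V)) :
  is_rooted_tree r par ->
  (forall v, 0 < c v) ->
  (forall q, q \in reqs -> rarr q <= rdead q) ->
  uniq [seq rdead q | q <- reqs] ->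
  (forall X : {set V}, perm_eq (enq X) (enum X)) ->
  forall sched : seq (service R V),
    feasible r par reqs sched ->
    sched_cost c (waterfall par c enq reqs)
      <= (depth par)%:R * sched_cost c sched.
Proof.
move=> tree c_gt0 arr_le rdead_uniq enqP sched feas.
rewrite /waterfall; set sreqs := sort _ reqs.
have sreqs_mem : sreqs =i reqs by move=> q; rewrite mem_sort.
have sreqs_sorted : sorted <%O [seq rdead q | q <- sreqs].
  rewrite lt_sorted_uniq_le sorted_map.
  rewrite (perm_uniq (perm_map _ (permEl (perm_sort _ reqs)))) rdead_uniq.
  by apply: sort_sorted => q q'; apply: le_total.
pose t0 := (\big[Num.min/0]_(q <- sreqs) rarr q) - 1.
have t0_lt q : q \in sreqs -> t0 < rarr q.
  by move=> q_in; rewrite ltrBlDr ltr_pwDr //; apply: (bigmin_inf_seq _ q).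
have c_ge0 v : 0 <= c v by apply: ltW.
have := @wf_run_competitive _ _ r par c enq sreqs t0 c_ge0 enqP t0_lt.
rewrite /past /wf_run take_size; apply=> // [q|].
  by rewrite sreqs_mem; apply: arr_le.
by split; [exact: feas.1 | move=> q; rewrite sreqs_mem; apply: feas.2].
Qed.
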